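(* Any 2-local derivation on the Lie algebra $W_\infty$ is a derivation of $W_\infty$.
   Context: All algebras are over $\mathbb{C}$. A derivation on a Lie algebra $L$ is a linear map $D:L\to L$ with $D([x,y])=[D(x),y]+[x,D(y)]$ for all $x,y\in L$. A 2-local derivation on $L$ is a map $\Delta:L\to L$ (not necessarily linear) such that for every $x,y\in L$ there exists a derivation $D_{x,y}:L\to L$ with $\Delta(x)=D_{x,y}(x)$ and $\Delta(y)=D_{x,y}(y)$. Let $\mathbb{Z}^\infty$ be the set of integer sequences $\alpha=(\alpha_1,\alpha_2,\ldots)$ with only finitely many nonzero entries, $A_\infty=\mathbb{C}[t_1^{\pm1},t_2^{\pm1},\ldots]$ the Laurent polynomial algebra in countably many variables, $t^\alpha=\prod_i t_i^{\alpha_i}$ for $\alpha\in\mathbb{Z}^\infty$, and $d_i=t_i\frac{\partial}{\partial t_i}$. The Witt algebra $W_\infty$ is the Lie algebra $\bigoplus_{i\ge1}A_\infty d_i$ of derivations of $A_\infty$ that are finite linear combinations of the $t^\alpha d_i$ ($\alpha\in\mathbb{Z}^\infty$, $i\ge 1$), with bracket $[t^\alpha d_i,t^\beta d_j]=\beta_i t^{\alpha+\beta}d_j-\alpha_j t^{\alpha+\beta}d_i$; equivalently $W_\infty=\bigcup_{n\ge1}W_n$ with $W_n=\mathrm{Der}(\mathbb{C}[t_1^{\pm1},\ldots,t_n^{\pm1}])$. *)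

(* Defs.v *)
From HB Require Import structures.
From mathcomp Require Import all_boot all_order all_algebra.
From mathcomp Require Import finmap monalg ring.

Set Implicit Arguments.
Unset Strict Implicit.
Unset Printing Implicit Defensive.

Import GRing.Theory.
Local Open Scope ring_scope.

HB.mixin Record Lmodule_isLieAlgebra (K : pzRingType) L
    of GRing.Lmodule K L := {
  bracket : L -> L -> L;
  bracket_linear_l : forall y : L, linear (bracket^~ y);
  bracket_linear_r : forall x : L, linear (bracket x);
  bracket_alt : forall x : L, bracket x x = 0;
  bracket_jacobi : forall x y z : L,
    bracket x (bracket y z) + bracket y (bracket z x)
      + bracket z (bracket x y) = 0
}.

#[short(type="lieAlgType")]
HB.structure Definition LieAlgebra (K : pzRingType) :=
  {L of GRing.Lmodule K L & Lmodule_isLieAlgebra K L}.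

Section Derivations.
Context (K : pzRingType) (L : lieAlgType K).

Definition is_derivation (D : L -> L) : Prop :=
  linear D /\
  (forall x y : L, D (bracket x y) = bracket (D x) y + bracket x (D y)).

Definition is_2local_derivation (Delta : L -> L) : Prop :=
  forall x y : L, exists D : L -> L,
    [/\ is_derivation D, Delta x = D x & Delta y = D y].

End Derivations.

(* Integer sequences with finite support: [alpha@_i] is the [i]-th entry.
   Indices start at 0, so [t_1, t_2, ...] are numbered [0, 1, ...]. *)
Notation Zinf := {malg int[nat]}.

(* The direct sum of the [A_infinity d_i]: the free module on the symbols
   [t^alpha d_i], encoded as [(alpha, i)], over the scalars [K]. *)
Definition Winf (K : comNzRingType) : Type := {malg K[(Zinf * nat)%type]}.

HB.instance Definition _ (K : comNzRingType) := GRing.Lmodule.on (Winf K).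

Section WittBracket.
Context (K : comNzRingType).
Implicit Types (p q r : Zinf * nat) (x y z : Winf K).

Definition td (alpha : Zinf) (i : nat) : Winf K := << (alpha, i) >>.

Definition td_bracket p q : Winf K :=
  let: (alpha, i) := p in let: (beta, j) := q in
  (beta@_i)%:~R *: td (alpha + beta) j - (alpha@_j)%:~R *: td (alpha + beta) i.

Definition Winf_bracket x y : Winf K :=
  \sum_(p <- msupp x) \sum_(q <- msupp y) (x@_p * y@_q) *: td_bracket p q.

Lemma Winf_bracketEw (A B : {fset (Zinf * nat)%type}) x y :
  (msupp x `<=` A)%fset -> (msupp y `<=` B)%fset ->
  Winf_bracket x y =
  \sum_(p <- A) \sum_(q <- B) (x@_p * y@_q) *: td_bracket p q.
Proof.
move=> sA sB; rewrite /Winf_bracket (big_fset_incl _ sA) /=; last first.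
  move=> p _ /mcoeff_outdom xp; rewrite big1 // => q _.
  by rewrite xp mul0r scale0r.
apply: eq_bigr => p _; apply: (big_fset_incl _ sB) => q _ /mcoeff_outdom yq.
by rewrite yq mulr0 scale0r.
Qed.

Lemma Winf_bracket_linear_l y : linear (Winf_bracket^~ y).
Proof.
move=> a u v /=; pose A := (msupp u `|` msupp v `|` msupp (a *: u + v))%fset.
have [su sv suv] : [/\ (msupp u `<=` A)%fset, (msupp v `<=` A)%fset
    & (msupp (a *: u + v) `<=` A)%fset].
  by split; apply/fsubsetP => k hk; rewrite !inE hk ?orbT.
rewrite (Winf_bracketEw suv (fsubset_refl _)).
rewrite (Winf_bracketEw su (fsubset_refl _)).
rewrite (Winf_bracketEw sv (fsubset_refl _)).
rewrite scaler_sumr -big_split; apply: eq_bigr => p _ /=.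
rewrite scaler_sumr -big_split; apply: eq_bigr => q _ /=.
by rewrite mcoeffD mcoeffZ mulrDl scalerDl -mulrA scalerA.
Qed.

Lemma td_bracketN p q : td_bracket p q = - td_bracket q p.
Proof.
by case: p q => [a i] [b j]; rewrite /td_bracket opprB (addrC b a).
Qed.

Lemma td_bracketxx p : td_bracket p p = 0.
Proof. by case: p => [a i]; rewrite /td_bracket subrr. Qed.

Lemma Winf_bracketN x y : Winf_bracket x y = - Winf_bracket y x.
Proof.
rewrite /Winf_bracket exchange_big /= -sumrN; apply: eq_bigr => q _.
rewrite -sumrN; apply: eq_bigr => p _.
by rewrite td_bracketN scalerN mulrC.
Qed.

Lemma Winf_bracket_linear_r x : linear (Winf_bracket x).
Proof.
move=> a u v; rewrite Winf_bracketN Winf_bracket_linear_l.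
by rewrite (Winf_bracketN x u) (Winf_bracketN x v) opprD scalerN.
Qed.

Lemma Winf_bracketUU p q : Winf_bracket << p >> << q >> = td_bracket p q.
Proof.
rewrite (Winf_bracketEw (msuppU_le (k := p)) (msuppU_le (k := q))).
by rewrite !big_seq_fset1 !mcoeffUU mulr1 scale1r.
Qed.

Lemma Winf_bracket_td (alpha beta : Zinf) (i j : nat) :
  Winf_bracket (td alpha i) (td beta j) =
  (beta@_i)%:~R *: td (alpha + beta) j - (alpha@_j)%:~R *: td (alpha + beta) i.
Proof. exact: Winf_bracketUU. Qed.

Lemma malg_sumE (T : choiceType) (g : {malg K[T]}) :
  g = \sum_(k <- msupp g) g@_k *: << k >>.
Proof.
rewrite {1}[g]monalgE; apply: eq_bigr => k _; apply/malgP => k'.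
by rewrite mcoeffZ !mcoeffU mulrnAr mulr1.
Qed.

Lemma Winf_sumE x : x = \sum_(p <- msupp x) x@_p *: (<< p >> : Winf K).
Proof. exact: malg_sumE. Qed.

Lemma Winf_linear_eq0 (f : Winf K -> Winf K) :
  linear f -> (forall p, f << p >> = 0) -> forall x, f x = 0.
Proof.
move=> fL f0 x; pose g : {linear Winf K -> Winf K} :=
  HB.pack f (GRing.isLinear.Build _ _ _ _ f fL).
rewrite -[f]/(g : _ -> _) [x]Winf_sumE linear_sum big1 // => p _.
by rewrite linearZ /= f0 scaler0.
Qed.

Lemma sum_alt (T : Type) (V : zmodType) (F : T -> T -> V) (s : seq T) :
  (forall t, F t t = 0) -> (forall t u, F t u = - F u t) ->
  \sum_(t <- s) \sum_(u <- s) F t u = 0.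
Proof.
move=> F0 FN; elim: s => [|r s IHs]; first by rewrite big_nil.
rewrite big_cons big_cons F0 add0r.
rewrite [X in _ + X](eq_bigr (fun t => F t r + \sum_(u <- s) F t u)); last first.
  by move=> t _; rewrite big_cons.
rewrite big_split /= IHs addr0 -big_split big1 // => t _ /=.
by rewrite (FN t r) subrr.
Qed.

Lemma Winf_bracket_alt x : Winf_bracket x x = 0.
Proof.
apply: sum_alt => [p|p q]; first by rewrite td_bracketxx scaler0.
by rewrite td_bracketN scalerN mulrC.
Qed.

Lemma linear_sum3 (V : lmodType K) (a : K) (u1 u2 u3 v1 v2 v3 : V) :
  (a *: u1 + v1) + (a *: u2 + v2) + (a *: u3 + v3) =
  a *: (u1 + u2 + u3) + (v1 + v2 + v3).
Proof. by rewrite !scalerDr (addrACA (a *: u1)) (addrACA (_ + _)). Qed.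

Lemma td_jacobi (V : lmodType K) (e : Zinf -> nat -> V) (br : V -> V -> V) :
    (forall v, linear (br v)) ->
    (forall (a b : Zinf) i j, br (e a i) (e b j) =
      (b@_i)%:~R *: e (a + b) j - (a@_j)%:~R *: e (a + b) i) ->
  forall (a b c : Zinf) i j k,
    br (e a i) (br (e b j) (e c k)) + br (e b j) (br (e c k) (e a i))
      + br (e c k) (br (e a i) (e b j)) = 0.
Proof.
move=> brL brE a b c i j k.
have br0 v : br v 0 = 0 by have := brL v (-1) 0 0; rewrite !scaleN1r oppr0 addr0 addNr.
have brZ v l w : br v (l *: w) = l *: br v w.
  by rewrite -[l *: w]addr0 brL br0 addr0.
have E (f g h : Zinf) l m n : br (e f l) (br (e g m) (e h n)) =
    ((h@_m)%:~R * ((h@_l)%:~R + (g@_l)%:~R)) *: e (f + (g + h)) n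
    + ((g@_n)%:~R * (f@_m)%:~R - (h@_m)%:~R * (f@_n)%:~R) *: e (f + (g + h)) l
    + (- ((g@_n)%:~R * ((h@_l)%:~R + (g@_l)%:~R))) *: e (f + (g + h)) m.
  rewrite (brE g) -scaleNr brL brZ !brE !mcoeffD !rmorphD /= !scalerBr !scalerA.
  rewrite !mulNr !scaleNr opprK scalerBl (addrC (g@_l)%:~R).
  by rewrite (AC (2*2) ((1*(4*2))*3)).
rewrite !E.
have -> : b + (c + a) = a + (b + c) by rewrite addrA addrC.
have -> : c + (a + b) = a + (b + c) by rewrite addrC addrA.
rewrite (AC ((3*3)*3) ((1*6*8)*(2*4*9)*(3*5*7))) /= -!scalerDl.
have Z t (w : V) : t = 0 -> t *: w = 0 by move=> ->; rewrite scale0r.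
by rewrite !Z ?addr0 //; ring.
Qed.

Let jac x y z := Winf_bracket x (Winf_bracket y z)
  + Winf_bracket y (Winf_bracket z x) + Winf_bracket z (Winf_bracket x y).

Let jac_linear y z : linear (fun x => jac x y z).
Proof.
move=> a u v; rewrite /jac !(Winf_bracket_linear_l, Winf_bracket_linear_r).
exact: linear_sum3.
Qed.

Let jac_cycle x y z : jac x y z = jac y z x.
Proof. by rewrite /jac [RHS]addrC addrA. Qed.

Let jac_td (a b c : Zinf) (i j k : nat) :
  jac (td a i) (td b j) (td c k) = 0.
Proof. exact: (td_jacobi Winf_bracket_linear_r Winf_bracket_td). Qed.

Lemma Winf_bracket_jacobi x y z :
  Winf_bracket x (Winf_bracket y z) + Winf_bracket y (Winf_bracket z x)
    + Winf_bracket z (Winf_bracket x y) = 0.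
Proof.
change (jac x y z = 0).
move: x; apply: (Winf_linear_eq0 (jac_linear y z)) => -[a i]; rewrite jac_cycle.
move: y; apply: (Winf_linear_eq0 (jac_linear z _)) => -[b j]; rewrite jac_cycle.
move: z; apply: (Winf_linear_eq0 (jac_linear _ _)) => -[c k]; rewrite jac_cycle.
exact: jac_td.
Qed.

HB.instance Definition _ := Lmodule_isLieAlgebra.Build K (Winf K)
  Winf_bracket_linear_l Winf_bracket_linear_r
  Winf_bracket_alt Winf_bracket_jacobi.

End WittBracket.

(* Main.v *)
Require Import Defs.
From mathcomp Require Import all_boot all_order all_algebra.
From mathcomp Require Import complex reals.
From mathcomp Require Import finmap monalg ring zify polyrcf.
From mathcomp Require Import boolp classical_sets cardinality ereal.
From mathcomp Require Import lebesgue_measure.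

Set Implicit Arguments.
Unset Strict Implicit.
Unset Printing Implicit Defensive.

Import Order.TTheory GRing.Theory Num.Theory.
Local Open Scope ring_scope.

(** The derivation axioms involve finitely many elements at a time, so it
    suffices to show that a 2-local derivation Delta agrees with a single
    derivation on any given finite list of elements ([twolocal_agrees]).

    Choose M such that all these elements involve only t_0, ..., t_(M-1) and
    d_0, ..., d_(M-1), put n = M + 3, and let c be transcendental.  The element
    d = sum_(l < n) c^l d_l is generic: t^g d_i is an eigenvector of ad d whose
    eigenvalue, the weight sum_(l < n) g_l c^l, determines g_0, ..., g_(n-1).
    Subtracting a derivation that agrees with Delta at d, one may assume
    Delta d = 0.

    A derivation D with D d = 0 preserves weights, and it is rigid: for a in
    Z^M it maps t^a d_i to p(a) t^a d_i, where p(a) is a Laurent polynomial in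
    t_n, t_(n+1), ... that does not depend on i and is additive in a
    ([multiplier_indep], [multiplierD]).  The three spare variables between M
    and n make this a short computation with commuting pairs and with t_M.  So
    for each x there is an additive p_x, possibly depending on x, such that
    Delta multiplies the part of x of degree a by p_x(a), for all a in Z^M.

    The heart of the proof is that p_x(a) does not depend on x
    ([twolocal_natmul], [twolocal_coef]).  Compare x with the test element
    y = t^(m a) d, m large.  A derivation D agreeing with Delta at x and y
    differs by some ad h from one that kills d, with h free of terms of weight
    zero ([derivation_ad_d]).  As Delta y has the same degree as y, ad h kills
    y, and by genericity every term of h has the weight of y.  Hence ad h moves
    a term of x into degree a only if it has degree (1 - m) a, and for m large x
    has no such term.  In degree a, Delta x is therefore the part of x of degree
    a times the additive multiplier of D at a, which is 1/m times the one at
    m a, and the latter is read off from Delta y.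

    It remains to take X, the sum of the t^a d_0 over all degrees a that occur
    in the list: a derivation that agrees with Delta at X and d has the same
    multipliers as Delta on the whole list.

    In coordinates, p(a) is the family of its coefficients, so the
    multiplier carries one more argument: an exponent g with
    g_0 = ... = g_(n-1) = 0. *)

(** * Lie brackets and derivations *)

Section LieDerivations.
Context (K : pzRingType) (L : lieAlgType K).
Implicit Types (x y z : L) (D : L -> L).

Lemma bracketBl x y z : bracket (x - y) z = bracket x z - bracket y z.
Proof. by rewrite addrC -scaleN1r bracket_linear_l scaleN1r addrC. Qed.

Lemma bracketBr x y z : bracket z (x - y) = bracket z x - bracket z y.
Proof. by rewrite addrC -scaleN1r bracket_linear_r scaleN1r addrC. Qed.

Lemma bracketDl x y z : bracket (x + y) z = bracket x z + bracket y z.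
Proof. by rewrite -[x]scale1r bracket_linear_l !scale1r. Qed.

Lemma bracketDr x y z : bracket z (x + y) = bracket z x + bracket z y.
Proof. by rewrite -[x]scale1r bracket_linear_r !scale1r. Qed.

Lemma bracket0r x : bracket x 0 = 0.
Proof. by have := bracketBr 0 0 x; rewrite !subrr. Qed.

Lemma bracketNr x y : bracket x (- y) = - bracket x y.
Proof. by rewrite -sub0r bracketBr bracket0r sub0r. Qed.

Lemma bracketN x y : bracket x y = - bracket y x.
Proof.
apply: (addIr (bracket y x)); rewrite addNr.
by have := bracket_alt (x + y); rewrite bracketDl !bracketDr !bracket_alt add0r addr0.
Qed.

Lemma bracket0l x : bracket 0 x = 0.
Proof. by rewrite bracketN bracket0r oppr0. Qed.

Lemma bracketZr (r : K) x y : bracket x (r *: y) = r *: bracket x y.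
Proof. by rewrite -[r *: y]addr0 bracket_linear_r bracket0r addr0. Qed.

Lemma bracket_sumr (I : Type) (s : seq I) x (F : I -> L) :
  bracket x (\sum_(i <- s) F i) = \sum_(i <- s) bracket x (F i).
Proof.
by apply: (big_morph (bracket x)) => [u v|]; rewrite ?bracketDr ?bracket0r.
Qed.

Lemma derivation0 D : is_derivation D -> D 0 = 0.
Proof.
case=> DL _; have := DL 1 0 0; rewrite !scale1r addr0 => D0.
by apply: (addIr (D 0)); rewrite add0r -D0.
Qed.

Lemma derivationZ D r x : is_derivation D -> D (r *: x) = r *: D x.
Proof. by move=> dD; rewrite -[r *: x]addr0 dD.1 derivation0 ?addr0. Qed.

Lemma derivationB D x y : is_derivation D -> D (x - y) = D x - D y.
Proof. by move=> dD; rewrite addrC -scaleN1r dD.1 scaleN1r addrC. Qed.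

Lemma derivation_sum D (I : Type) (s : seq I) (r : I -> K) (F : I -> L) :
  is_derivation D -> D (\sum_(i <- s) r i *: F i) = \sum_(i <- s) r i *: D (F i).
Proof.
move=> dD; elim: s => [|i s IH]; first by rewrite !big_nil derivation0.
by rewrite !big_cons dD.1 IH.
Qed.

Lemma is_derivationD D1 D2 : is_derivation D1 -> is_derivation D2 ->
  is_derivation (fun x => D1 x + D2 x).
Proof.
move=> [L1 M1] [L2 M2]; split=> [r x y|x y]; first by rewrite L1 L2 scalerDr addrACA.
by rewrite M1 M2 bracketDl bracketDr addrACA.
Qed.

Lemma is_derivationB D1 D2 : is_derivation D1 -> is_derivation D2 ->
  is_derivation (fun x => D1 x - D2 x).
Proof.
move=> [L1 M1] [L2 M2]; split=> [r x y|x y].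
  by rewrite L1 L2 scalerBr opprD addrACA.
by rewrite M1 M2 bracketBl bracketBr opprD addrACA.
Qed.

Lemma is_derivation_ad h : is_derivation (bracket h : L -> L).
Proof.
split=> [|x y]; first exact: bracket_linear_r.
have /eqP := bracket_jacobi h x y; rewrite -addrA addr_eq0 => /eqP ->.
by rewrite opprD addrC (bracketN y h) bracketNr opprK (bracketN (bracket h x)).
Qed.

End LieDerivations.

(** * Bases with the Witt bracket *)

(** The proof uses only the multiplication of the basis t^a d_i, here [mono],
    and the coordinates [wcoef] in it.  The list [support] may be any finite list
    that makes the expansion true. *)
Record witt_basis (K : numFieldType) (L : lieAlgType K) := WittBasis {
  mono : Zinf -> nat -> L;
  wcoef : L -> Zinf -> nat -> K;
  support : L -> seq (Zinf * nat);
  wcoef_scalar : forall a i, scalar (fun x => wcoef x a i);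
  wcoef_mono : forall a i b j, wcoef (mono a i) b j = ((a == b) && (i == j))%:R;
  wcoef_expansion : forall x,
    x = \sum_(p <- support x) wcoef x p.1 p.2 *: mono p.1 p.2;
  bracket_mono : forall a b i j, bracket (mono a i) (mono b j) =
    (b@_i)%:~R *: mono (a + b) j - (a@_j)%:~R *: mono (a + b) i
}.

(** * Exponents *)

Section Exponents.
Implicit Types (g a : Zinf).

Lemma fresh_index g : exists j, g@_j = 0.
Proof.
exists (\max_(i <- msupp g) i).+1; apply: mcoeff_outdom; apply/negP => gj.
by have := @leq_bigmax_seq _ (enum_fset (msupp g)) xpredT id _ gj isT; rewrite ltnn.
Qed.

(** This provides the large m of the main argument: in a coordinate where a does
    not vanish, a - (m + 1) a grows linearly in m. *)
Lemma natmul_avoid a (s : seq Zinf) : a != 0 ->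
  exists m, forall b, b \in s -> b != a - a *+ m.+1.
Proof.
move=> a0; have [l al] : exists l, a@_l != 0.
  have [s0|[l al]] := fset_0Vmem (msupp a).
    by case/eqP: a0; apply/malgP => l; rewrite mcoeff0 mcoeff_outdom // s0 inE.
  by exists l; rewrite mcoeff_neq0.
exists (\sum_(b <- s) `|b@_l|).+1%N => b bs; apply: contra_neq al => bE.
have : (`|b@_l| <= \sum_(b' <- s) `|b'@_l|)%N by rewrite (big_rem b bs) leq_addr.
rewrite bE mcoeffB mcoeffMn; nia.
Qed.

Definition low n g : Zinf := \sum_(l < n) << g@_(nat_of_ord l) *g nat_of_ord l >>.

Lemma mcoeff_low n g l : (low n g)@_l = if (l < n)%N then g@_l else 0.
Proof.
rewrite /low raddf_sum /=; case: ltnP => ln.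
  rewrite (bigD1 (Ordinal ln)) //= mcoeffUU big1 ?addr0 // => i.
  by rewrite -val_eqE mcoeffU /= => /negPf ->.
by rewrite big1 // => i _; rewrite mcoeffU ltn_eqF // (leq_trans (ltn_ord i)).
Qed.

Definition in_Z n a := forall l, (n <= l)%N -> a@_l = 0.

End Exponents.

(** * The bracket in coordinates *)

Section WittCalculus.
Context (K : numFieldType) (L : lieAlgType K) (B : witt_basis L).
Implicit Types (x y : L) (a b e g : Zinf) (D : L -> L).
Local Notation t := (mono B).
Local Notation co := (wcoef B).

Lemma wcoefB x y a i : co (x - y) a i = co x a i - co y a i.
Proof. by rewrite addrC -scaleN1r (wcoef_scalar B) mulN1r addrC. Qed.

Lemma wcoef0 a i : co 0 a i = 0.
Proof. by rewrite -(subrr 0) wcoefB subrr. Qed.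

Lemma wcoefD x y a i : co (x + y) a i = co x a i + co y a i.
Proof. by rewrite -[x]scale1r (wcoef_scalar B) mul1r scale1r. Qed.

Lemma wcoefN x a i : co (- x) a i = - co x a i.
Proof. by rewrite -sub0r wcoefB wcoef0 sub0r. Qed.

Lemma wcoefZ (r : K) x a i : co (r *: x) a i = r * co x a i.
Proof. by rewrite -[r *: x]addr0 (wcoef_scalar B) wcoef0 addr0. Qed.

Lemma wcoef_sum (I : Type) (s : seq I) (F : I -> L) a i :
  co (\sum_(j <- s) F j) a i = \sum_(j <- s) co (F j) a i.
Proof.
by apply: (big_morph (fun x => co x a i)) => [x y|]; rewrite ?wcoefD ?wcoef0.
Qed.

Lemma wcoef_inj x y : (forall a i, co x a i = co y a i) -> x = y.
Proof.
move=> xy; apply/eqP; rewrite -subr_eq0 [x - y](wcoef_expansion B) big1 // => p _.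
by rewrite wcoefB xy subrr scale0r.
Qed.

Lemma eq_scalar_mono (f h : L -> K) : scalar f -> scalar h ->
  (forall a i, f (t a i) = h (t a i)) -> f =1 h.
Proof.
have f0 (f' : L -> K) : scalar f' -> f' 0 = 0.
  by move=> fL; have := fL (-1) 0 0; rewrite scaler0 addr0 mulN1r addNr.
move=> fL hL fh x; rewrite [x](wcoef_expansion B).
elim: (support B x) => [|p s IH]; first by rewrite big_nil !f0.
by rewrite big_cons fL hL fh IH.
Qed.

(** The coefficient at t^(e + b) of the function x(t^b), where x acts as a
    derivation of Laurent polynomials. *)
Definition contraction b x e : K := \sum_(m <- msupp b) (b@_m)%:~R * co x e m.

Lemma contraction_scalar b e : scalar (fun x => contraction b x e).
Proof.
move=> r x y; rewrite /contraction mulr_sumr -big_split /=.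
by apply: eq_bigr => m _; rewrite (wcoef_scalar B) mulrDr mulrCA.
Qed.

Lemma contraction1 b x e i : (forall m, m != i -> co x e m = 0) ->
  contraction b x e = (b@_i)%:~R * co x e i.
Proof.
move=> xi; rewrite /contraction.
have [ib|/[dup] /mcoeff_outdom -> ib] := boolP (i \in msupp b).
  rewrite (bigD1_seq i) ?fset_uniq //= big1 ?addr0 // => m mi.
  by rewrite xi ?mulr0.
rewrite mul0r big_seq big1 // => m mb; rewrite xi ?mulr0 //.
by apply: contraNneq ib => <-.
Qed.

Lemma contraction0 x e : contraction 0 x e = 0.
Proof. by rewrite /contraction msupp0 big_seq_fset0. Qed.

Lemma contractionU x e i : contraction << i >> x e = co x e i.
Proof. by rewrite /contraction msuppU oner_eq0 big_seq_fset1 mcoeffUU mul1r. Qed.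

Lemma wcoef_bracket_mono x b j e k : co (bracket x (t b j)) e k =
  (j == k)%:R * contraction b x (e - b) - ((e - b)@_j)%:~R * co x (e - b) k.
Proof.
pose f x := co (bracket x (t b j)) e k.
pose h x := (j == k)%:R * contraction b x (e - b)
    - ((e - b)@_j)%:~R * co x (e - b) k.
apply: (@eq_scalar_mono f h) => [r u v|r u v|a i]; rewrite /f /h {f h}.
- by rewrite bracket_linear_l (wcoef_scalar B).
- by rewrite contraction_scalar (wcoef_scalar B); ring.
rewrite bracket_mono wcoefB !wcoefZ (@contraction1 _ _ _ i) => [|m mi]; last first.
  by rewrite wcoef_mono andbC eq_sym (negPf mi).
rewrite !wcoef_mono eqxx andbT (eq_sym a (e - b)) subr_eq (eq_sym (a + b)).
have [->|_] := eqVneq e (a + b); last by rewrite /= !mulr0 subrr.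
by rewrite addrK /=; ring.
Qed.

End WittCalculus.

(** * A generic element of the torus *)

Section GenericTorus.
Context (K : numFieldType) (L : lieAlgType K) (B : witt_basis L).
Context (c : K) (M : nat).
Implicit Types (x y : L) (a b e g : Zinf) (D : L -> L).
Local Notation t := (mono B).
Local Notation co := (wcoef B).
Local Notation n := M.+3.

(** The eigenvalue of ad d on the t^g d_i, where d = [curve_field 0]. *)
Definition weight g : K := \sum_(l < n) (g@_(nat_of_ord l))%:~R * c ^+ l.

(** The field t^a (sum_l c^l d_l), whose direction is a point of the moment
    curve. *)
Definition curve_field a : L := \sum_(l < n) c ^+ l *: t a l.

Local Notation d := (curve_field 0).

Hypothesis weight_eq0 : forall g, weight g = 0 -> forall l, (l < n)%N -> g@_l = 0.

Lemma weightD a b : weight (a + b) = weight a + weight b.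
Proof.
rewrite /weight -big_split; apply: eq_bigr => l _.
by rewrite mcoeffD rmorphD /= mulrDl.
Qed.

Lemma weightN a : weight (- a) = - weight a.
Proof.
rewrite /weight -sumrN; apply: eq_bigr => l _.
by rewrite mcoeffN rmorphN /= mulNr.
Qed.

Lemma weight0P g : weight g = 0 <-> (forall l, (l < n)%N -> g@_l = 0).
Proof.
split=> [/weight_eq0//|g0]; rewrite /weight big1 // => l _.
by rewrite g0 // mul0r.
Qed.

Lemma wcoef_curve_field a e k :
  co (curve_field a) e k = ((a == e) && (k < n)%N)%:R * c ^+ k.
Proof.
rewrite /curve_field wcoef_sum.
under eq_bigr do rewrite wcoefZ wcoef_mono.
case: ltnP => kn; last first.
  rewrite andbF mul0r big1 // => l _.
  by rewrite ltn_eqF ?andbF ?mulr0 // (leq_trans (ltn_ord l)).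
rewrite (bigD1 (Ordinal kn)) //= eqxx big1 ?addr0 1?mulrC // => l.
by rewrite -val_eqE /= => /negPf ->; rewrite andbF mulr0.
Qed.

Lemma wcoef_bracket_curve_field x b e k : co (bracket x (curve_field b)) e k =
  (k < n)%N%:R * c ^+ k * contraction B b x (e - b) - weight (e - b) * co x (e - b) k.
Proof.
rewrite /curve_field bracket_sumr wcoef_sum.
under eq_bigr do rewrite bracketZr wcoefZ wcoef_bracket_mono mulrBr.
rewrite sumrB; congr (_ - _); last first.
  by rewrite /weight mulr_suml; apply: eq_bigr => l _; rewrite mulrCA mulrA.
case: ltnP => kn; last first.
  rewrite !mul0r big1 // => l _.
  by rewrite ltn_eqF ?mul0r ?mulr0 // (leq_trans (ltn_ord l)).
rewrite (bigD1 (Ordinal kn)) //= eqxx !mul1r big1 ?addr0 // => l.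
by rewrite -val_eqE /= => /negPf ->; rewrite mul0r mulr0.
Qed.

Lemma wcoef_bracket_d x e k : co (bracket x d) e k = - weight e * co x e k.
Proof. by rewrite wcoef_bracket_curve_field contraction0 mulr0 sub0r subr0 mulNr. Qed.

Lemma wcoef_d_bracket x e k : co (bracket d x) e k = weight e * co x e k.
Proof. by rewrite bracketN wcoefN wcoef_bracket_d mulNr opprK. Qed.

Lemma bracket_d_mono a i : bracket d (t a i) = weight a *: t a i.
Proof.
apply: (@wcoef_inj _ _ B) => e k; rewrite wcoef_d_bracket wcoefZ wcoef_mono.
by have [->|] := eqVneq a e; rewrite ?mulr0.
Qed.

(** * Derivations that kill the generic element *)

Section VanishingOnTorus.
Context (D : L -> L).
Hypotheses (dD : is_derivation D) (Dd : D d = 0).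

Lemma wcoef_derivation_weight a i e k : weight e != weight a -> co (D (t a i)) e k = 0.
Proof.
move=> ea; have /(congr1 (fun x => co x e k)) := dD.2 d (t a i).
rewrite Dd bracket0l add0r bracket_d_mono (derivationZ _ _ dD) wcoefZ wcoef_d_bracket.
move=> /eqP; rewrite -subr_eq0 -mulrBl mulf_eq0 subr_eq0 eq_sym (negPf ea) /=.
by move/eqP.
Qed.

(** As a_l = 0 and k <> i, the fields t^a d_i and t_k d_l commute.  Applying D to
    this relation and reading off the coefficient at d_l isolates the component
    of D (t^a d_i) along d_k: all other contributions vanish because D preserves
    weights. *)
Lemma wcoef_derivation_offdiag a i l k e : (i < n)%N -> (l < n)%N -> l != i ->
  a@_l = 0 -> k != i -> co (D (t a i)) e k = 0.
Proof.
move=> in_ ln li al ki.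
have [ea|/wcoef_derivation_weight ->//] := eqVneq (weight e) (weight a).
have eq_ea m : (m < n)%N -> e@_m = a@_m.
  move=> mn; apply/eqP; rewrite -subr_eq0 -mcoeffB; apply/eqP.
  by apply: weight_eq0 => //; rewrite weightD weightN ea subrr.
have /(congr1 (fun x => co x (e + << k >>) l)) := dD.2 (t a i) (t << k >> l).
rewrite bracket_mono al scale0r subr0 mcoeffU (negPf ki) scale0r (derivation0 dD).
rewrite wcoef0 wcoefD wcoef_bracket_mono eqxx mul1r addrK contractionU eq_ea // al.
rewrite mul0r subr0 bracketN wcoefN wcoef_bracket_mono eq_sym (negPf li) mul0r sub0r.
rewrite mcoeffB mcoeffD mcoeffU (negPf ki) addr0 eq_ea // subrr mul0r oppr0 oppr0.
by rewrite addr0.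
Qed.

Definition diagonal a := forall i e k, (i < n)%N -> k != i -> co (D (t a i)) e k = 0.

(** Of two zeros of a, one is at an index other than i, whatever i is. *)
Lemma diagonal_two_zeros a l l' : (l < n)%N -> (l' < n)%N -> l != l' ->
  a@_l = 0 -> a@_l' = 0 -> diagonal a.
Proof.
move=> ln ln' ll al al' i e k in_ ki.
have [il|il] := eqVneq l i; last exact: (@wcoef_derivation_offdiag a i l).
by apply: (@wcoef_derivation_offdiag a i l') => //; rewrite -il eq_sym.
Qed.

(** The coefficient at t^g of the factor by which D multiplies t^a d_i. *)
Definition multiplier g a i := co (D (t a i)) (a + g) i.

(** The coefficient at t^(a + b + g) d_j of the derivation rule for
    [t^a d_i, t^b d_j].  The second term on the left vanishes for i <> j as soon
    as D (t^(a + b) d_i) is diagonal. *)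
Lemma multiplier_bracket g a b i j : (forall l, (l < n)%N -> g@_l = 0) ->
    diagonal a -> diagonal b -> (i < n)%N -> (j < n)%N ->
  (b@_i)%:~R * multiplier g (a + b) j
    - (a@_j)%:~R * co (D (t (a + b) i)) (a + b + g) j =
  (b@_i)%:~R * (multiplier g a i + multiplier g b j)
    - (i == j)%:R * (a@_i)%:~R * (multiplier g a i + multiplier g b i).
Proof.
move=> g0 da db in_ jn.
have /(congr1 (fun x => co x (a + b + g) j)) := dD.2 (t a i) (t b j).
rewrite bracket_mono (derivationB _ _ dD) !(derivationZ _ _ dD) wcoefB !wcoefZ => ->.
have ag : a + b + g - b = a + g by rewrite addrAC addrK.
have bg : a + b + g - a = b + g by rewrite addrAC [a + b]addrC addrK.
rewrite wcoefD wcoef_bracket_mono eqxx mul1r ag.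
rewrite (bracketN (t a i)) wcoefN wcoef_bracket_mono bg.
rewrite (@contraction1 _ _ B b _ _ i) => [|m mi]; last exact: da.
rewrite (@contraction1 _ _ B a _ _ j) => [|m mj]; last exact: db.
rewrite !mcoeffD !g0 // !addr0 -!/(multiplier _ _ _).
have ring_eq (r s p q : K) :
  r * p - s * p - (s * q - r * q) = r * (p + q) - s * (p + q) by ring.
have [<-|ij] := eqVneq i j; first by rewrite !mul1r ring_eq.
by rewrite [co (D (t a i)) _ j]da 1?eq_sym // mulr0 !mul0r subr0 sub0r opprK mulrDr subr0.
Qed.

Lemma multiplierD_neq g a b i j : (forall l, (l < n)%N -> g@_l = 0) ->
    diagonal a -> diagonal b -> diagonal (a + b) -> (i < n)%N -> (j < n)%N ->
    i != j -> b@_i != 0 ->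
  multiplier g (a + b) j = multiplier g a i + multiplier g b j.
Proof.
move=> g0 da db dab in_ jn ij bi.
have := multiplier_bracket g0 da db in_ jn; rewrite (negPf ij) !mul0r subr0.
rewrite (dab i) 1?eq_sym // mulr0 subr0 => /mulfI; apply.
by rewrite intr_eq0.
Qed.

Lemma multiplierD_eq g a b i : (forall l, (l < n)%N -> g@_l = 0) ->
    diagonal a -> diagonal b -> (i < n)%N -> b@_i != a@_i ->
  multiplier g (a + b) i = multiplier g a i + multiplier g b i.
Proof.
move=> g0 da db in_ bi.
have := multiplier_bracket g0 da db in_ in_; rewrite eqxx mul1r -!mulrBl.
by move/mulfI; apply; rewrite -rmorphB intr_eq0 subr_eq0.
Qed.

Lemma diagonal_in_Z a : in_Z M.+1 a -> diagonal a.
Proof.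
by move=> a0; apply: (@diagonal_two_zeros a M.+1 M.+2); rewrite ?a0 // ltn_eqF.
Qed.

(** Since n >= 3, two of the indices 0, 1, 2 differ from i. *)
Lemma diagonalU i (r : int) : (i < n)%N -> diagonal << r *g i >>.
Proof.
move=> in_; apply: (@diagonal_two_zeros _ (i == 0%N) (2 - (i == 2%N))).
- by case: (i == 0%N).
- by case: (i == 2%N).
- by case: i {in_} => [|[|[|]]].
- by rewrite mcoeffU; case: i {in_} => [|[|[|]]].
- by rewrite mcoeffU; case: i {in_} => [|[|[|]]].
Qed.

Lemma multiplier0 g i : (forall l, (l < n)%N -> g@_l = 0) -> (i < n)%N ->
  multiplier g 0 i = 0.
Proof.
move=> g0 in_; have d1 := @diagonalU i 1 in_.
have d0 : diagonal 0 by apply: diagonal_in_Z => l _; rewrite mcoeff0.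
have := @multiplierD_eq g 0 << i >> i g0 d0 d1 in_.
rewrite mcoeff0 mcoeffUU => /(_ isT); rewrite add0r -[LHS]add0r.
by move/addIr.
Qed.

Lemma in_Z_add m a b : in_Z m a -> in_Z m b -> in_Z m (a + b).
Proof. by move=> az bz l ml; rewrite mcoeffD az // bz. Qed.

Lemma in_ZU m (r : int) i : (i < m)%N -> in_Z m << r *g i >>.
Proof. by move=> im l ml; rewrite mcoeffU ltn_eqF // (leq_trans im). Qed.

(** The bracket of t^a t_M^-1 d_M and t_M d_i is t^a d_i minus a multiple of
    t^a d_M.  Its component along d_i shows that the multipliers of t^a d_i and
    t^a d_M differ by a quantity independent of a, which is zero because both
    multipliers vanish for a = 0. *)
Lemma multiplier_indep g a i : (forall l, (l < n)%N -> g@_l = 0) -> in_Z M a ->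
  (i < n)%N -> multiplier g a i = multiplier g a M.
Proof.
move=> g0 aM in_; have [->//|iM] := eqVneq i M.
have Mn : (M < n)%N by lia.
have aM1 b : in_Z M b -> in_Z M.+1 b by move=> bM l Ml; apply: bM; lia.
have key b : in_Z M b -> multiplier g b i =
    multiplier g b M + multiplier g << - 1 *g M >> M + multiplier g << M >> i.
  move=> bM; rewrite -(multiplierD_eq g0) ?mcoeffUU ?bM //; last 2 first.
  - exact/diagonal_in_Z/aM1.
  - exact/diagonalU.
  have bE : b = (b + << - 1 *g M >>) + << M >>.
    by rewrite -addrA -monalgUD addNr monalgU0 addr0.
  rewrite {1}bE (@multiplierD_neq _ _ _ M) -?bE ?mcoeffUU 1?eq_sym //.
  - by apply: diagonal_in_Z; apply: in_Z_add; [exact: aM1|exact: in_ZU].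
  - exact: diagonalU.
  - exact/diagonal_in_Z/aM1.
have := key 0 (fun l _ => mcoeff0 l); rewrite !multiplier0 // add0r => Mi.
by rewrite key // -addrA -Mi addr0.
Qed.

(** The bracket of t^a d_M and t^b d_M is zero and says nothing about a + b.  The
    detour through t^b t_M d_M makes the M-th exponents differ. *)
Lemma multiplierD g a b : (forall l, (l < n)%N -> g@_l = 0) -> in_Z M a -> in_Z M b ->
  multiplier g (a + b) M = multiplier g a M + multiplier g b M.
Proof.
move=> g0 az bz; have Mn : (M < n)%N by lia.
have aM1 b' : in_Z M b' -> in_Z M.+1 b' by move=> bM l Ml; apply: bM; lia.
have shift b' : in_Z M b' ->
    multiplier g (b' + << M >>) M = multiplier g b' M + multiplier g << M >> M.
  move=> bz'; apply: multiplierD_eq => //; last by rewrite mcoeffUU bz'.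
  - exact/diagonal_in_Z/aM1.
  - exact: diagonalU.
apply: (addIr (multiplier g << M >> M)); rewrite -shift; last exact: in_Z_add.
rewrite -addrA (multiplierD_eq g0) ?shift ?addrA //.
- exact/diagonal_in_Z/aM1.
- by apply: diagonal_in_Z; apply: in_Z_add; [exact: aM1|exact: in_ZU].
- by rewrite mcoeffD mcoeffUU az // bz.
Qed.

Lemma multiplierMn g a m : (forall l, (l < n)%N -> g@_l = 0) -> in_Z M a ->
  multiplier g (a *+ m) M = m%:R * multiplier g a M.
Proof.
move=> g0 az; elim: m => [|m IH]; first by rewrite mulr0n mul0r multiplier0 //; lia.
have amz : in_Z M (a *+ m) by move=> l Ml; rewrite mcoeffMn az // mul0rn.
by rewrite mulrS multiplierD // IH -[in RHS]nat1r mulrDl mul1r.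
Qed.

(** The directions d_M, ..., d_(n-1) are allowed in order to include the test
    elements [curve_field a] with a in Z^M. *)
Definition windowed x := forall a i, co x a i != 0 -> in_Z M a /\ (i < n)%N.

(** Only the term of degree [low n e] contributes, because weights are preserved
    and a weight determines a degree in Z^M. *)
Lemma wcoef_derivation_windowed x e k : windowed x ->
  co (D x) e k = multiplier (e - low n e) (low n e) M * co x (low n e) k.
Proof.
move=> xW; rewrite {2}[x](wcoef_expansion B) {1}[x](wcoef_expansion B).
rewrite (derivation_sum _ _ _ dD) !wcoef_sum mulr_sumr; apply: eq_bigr => -[a i] _ /=.
rewrite !wcoefZ mulrCA; have [->|/xW[az in_]] := eqVneq (co x a i) 0; first by rewrite !mul0r.
congr (_ * _); rewrite wcoef_mono.
have [->|ki] := eqVneq k i; last first.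
  by rewrite (@diagonal_in_Z a) // 1?eq_sym ?(negPf ki) ?andbF ?mulr0 // => l /ltnW /az.
rewrite andbT; have [aE|ae] := eqVneq a (low n e).
  rewrite -aE mulr1 -(@multiplier_indep _ _ i) //; first by rewrite /multiplier addrC subrK.
  by move=> l ln; rewrite aE mcoeffB mcoeff_low ln subrr.
rewrite mulr0 wcoef_derivation_weight //; apply: contra_neq ae => ea.
apply/malgP => l; rewrite mcoeff_low; case: ltnP => ln; last by rewrite az //; lia.
apply/eqP; rewrite eq_sym -subr_eq0 -mcoeffB; apply/eqP.
by apply: weight_eq0 => //; rewrite weightD weightN ea subrr.
Qed.

End VanishingOnTorus.

Lemma low_add a g : in_Z M a -> (forall l, (l < n)%N -> g@_l = 0) -> low n (a + g) = a.
Proof.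
move=> az g0; apply/malgP => l; rewrite mcoeff_low; case: ltnP => ln.
  by rewrite mcoeffD g0 // addr0.
by rewrite az //; lia.
Qed.

(** * Reduction to derivations that kill the generic element *)

Lemma contraction_curve_field b : contraction B b (curve_field 0) 0 = weight b.
Proof.
have := wcoef_bracket_mono B d b 0 b 0.
by rewrite bracket_d_mono wcoefZ wcoef_mono !eqxx mulr1 mul1r subrr mcoeff0 mul0r subr0.
Qed.

(** Comparing D [d, t^a d_i] with the derivation rule in degree a + g shows that
    the part of D d of weight zero commutes with every t^a d_i; and the centre of
    the Lie algebra is trivial, as a = e_k and an index i = j with g_j = 0
    show. *)
Lemma wcoef_derivation_d D g k : is_derivation D -> weight g = 0 -> co (D d) g k = 0.
Proof.
move=> dD g0; have bracket0 a i j : co (bracket (D d) (t a i)) (a + g) j = 0.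
  have /(congr1 (fun x => co x (a + g) j)) := dD.2 d (t a i).
  rewrite bracket_d_mono (derivationZ _ _ dD) wcoefZ wcoefD wcoef_d_bracket.
  by rewrite weightD g0 addr0 -[LHS]add0r => /addIr.
have [j gj] := fresh_index g.
have := bracket0 << k >> j j; rewrite wcoef_bracket_mono eqxx mul1r addrAC subrr add0r.
by rewrite contractionU gj mul0r subr0.
Qed.

(** ad d is invertible on the terms of nonzero weight, and D d has no others. *)
Lemma derivation_ad_d D : is_derivation D -> exists h,
  D d = bracket h d /\ (forall g k, weight g = 0 -> co h g k = 0).
Proof.
move=> dD; pose h := \sum_(p <- support B (D d))
  (- (weight p.1)^-1 * co (D d) p.1 p.2) *: t p.1 p.2.
have hE g k : co h g k = - (weight g)^-1 * co (D d) g k.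
  rewrite [in RHS](wcoef_expansion B (D d)) !wcoef_sum mulr_sumr.
  apply: eq_bigr => p _; rewrite !wcoefZ wcoef_mono mulrA.
  by have [->|] := eqVneq p.1 g; rewrite ?mulr0.
exists h; split=> [|g k g0]; last by rewrite hE wcoef_derivation_d ?mulr0.
apply: (@wcoef_inj _ _ B) => g k; rewrite wcoef_bracket_d hE.
have [g0|g0] := eqVneq (weight g) 0; first by rewrite wcoef_derivation_d // g0 oppr0 mul0r.
by rewrite mulrA mulrNN mulfV // mul1r.
Qed.

Lemma wcoef_support x a i : co x a i != 0 -> (a, i) \in support B x.
Proof.
apply: contraR => ax; rewrite [x](wcoef_expansion B) wcoef_sum big_seq big1 // => p px.
rewrite wcoefZ wcoef_mono -xpair_eqE -surjective_pairing.
by have [pE|] := eqVneq p (a, i); rewrite ?mulr0 //; rewrite -pE px in ax.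
Qed.

Lemma windowed_curve_field a : in_Z M a -> windowed (curve_field a).
Proof.
move=> az b i; rewrite wcoef_curve_field; have [<-|] := eqVneq a b; last by rewrite mul0r eqxx.
by case: ltnP => // _; rewrite mul0r eqxx.
Qed.

Lemma natmul_in_Z m a k : in_Z m a -> in_Z m (a *+ k).
Proof. by move=> az l ml; rewrite mcoeffMn az // mul0rn. Qed.

(** * 2-local derivations that kill the generic element *)

Section TwoLocal.
Context (Delta : L -> L).
Hypotheses (locD : is_2local_derivation Delta) (Delta_d : Delta d = 0).

(** The comparison of x with the test element y = t^(m a) d, where x has no term
    of degree (1 - m) a. *)
Lemma twolocal_natmul x a g k m : windowed x -> in_Z M a ->
    (forall l, (l < n)%N -> g@_l = 0) -> (forall i, co x (a - a *+ m) i = 0) ->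
  m%:R * co (Delta x) (a + g) k =
  co (Delta (curve_field (a *+ m))) (a *+ m + g) 0 * co x a k.
Proof.
move=> xW az g0 xm; set A := a *+ m; set y := curve_field A.
have Az : in_Z M A by exact: natmul_in_Z.
have yW : windowed y by exact: windowed_curve_field.
have wg : weight g = 0 by apply/weight0P.
have y0 : co y A 0 = 1 by rewrite wcoef_curve_field eqxx expr0 mul1r.
have lowA : low n (A + g) = A by exact: low_add.
have lowa : low n (a + g) = a by exact: low_add.
(* Delta y has no terms outside the degree of y. *)
have Delta_y e i : low n e != A -> co (Delta y) e i = 0.
  move=> eA; have [D1 [dD1 -> E2]] := locD y d.
  rewrite wcoef_derivation_windowed -?E2 // wcoef_curve_field eq_sym (negPf eA).
  by rewrite mul0r mulr0.
have [D2 [dD2 D2x D2y]] := locD x y.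
have [h [hd h0]] := derivation_ad_d dD2.
have [D3 [dD3 D3d D2E]] : exists D3,
    [/\ is_derivation D3, D3 d = 0 & forall z, D2 z = D3 z + bracket h z].
  exists (fun z => D2 z - bracket h z); split=> [||z]; last by rewrite subrK.
    by apply: is_derivationB => //; exact: is_derivation_ad.
  by rewrite hd subrr.
(* In degree g' + m a, the equation [h, y] = 0 says that the component of h at
   g' is u d for a scalar u, and then that u (weight g' - weight (m a)) = 0. *)
have h_weight g' i : weight g' != weight A -> co h g' i = 0.
  move=> gA; have [/h0->//|g'0] := eqVneq (weight g') 0.
  have lowg : low n (g' + A) != A.
    apply: contra_neq g'0 => gE; apply/weight0P => l ln.
    have := congr1 (fun b : Zinf => b@_l) gE.
    by rewrite mcoeff_low ln mcoeffD -[RHS]add0r => /addIr.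
  have hy j : co h g' j =
      (j < n)%N%:R * c ^+ j * (contraction B A h g' / weight g').
    have : co (bracket h y) (g' + A) j = 0.
      rewrite -[bracket h y]addr0 -(subrr (D3 y)) addrCA addrA -D2E wcoefB -D2y.
      rewrite Delta_y // (wcoef_derivation_windowed dD3 D3d) // wcoef_curve_field.
      by rewrite eq_sym (negPf lowg) mul0r mulr0 subrr.
    rewrite wcoef_bracket_curve_field addrK => /eqP; rewrite subr_eq0 => /eqP E.
    by rewrite mulrA E mulrAC mulfV // mul1r.
  suff C0 : contraction B A h g' = 0 by rewrite hy C0 mul0r mulr0.
  apply/eqP; have : contraction B A h g' * (weight g' - weight A) = 0.
    apply: (mulIf (invr_neq0 g'0)); rewrite mul0r mulrAC mulrBr mulfVK //.
    rewrite -(contraction_curve_field A) {1}/contraction /(contraction _ _ d) mulr_sumr.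
    rewrite -sumrB big1 // => l _; rewrite hy wcoef_curve_field eqxx /=.
    by rewrite [X in _ - X]mulrC -(mulrA (A@_l)%:~R) subrr.
  by move/eqP; rewrite mulf_eq0 subr_eq0 (negPf gA) orbF.
(* A term of x that ad h moves to degree a has degree a - m a. *)
have hx : co (bracket h x) (a + g) k = 0.
  rewrite [x](wcoef_expansion B) bracket_sumr wcoef_sum big1 // => -[b j] _ /=.
  rewrite bracketZr wcoefZ; have [->|xb] := eqVneq (co x b j) 0; first by rewrite mul0r.
  have [bz _] := xW _ _ xb.
  have bA : weight (a + g - b) != weight A.
    apply: contra_neq xb => wE; rewrite (_ : b = a - A) //.
    apply/malgP => l; rewrite mcoeffB; case: (ltnP l M) => lM; last first.
      by rewrite bz // az // Az // subrr.
    have /weight_eq0 : weight (a + g - b - A) = 0 by rewrite weightD weightN wE subrr.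
    move/(_ l ltac:(lia)); rewrite !mcoeffB mcoeffD g0 ?addr0; last by lia.
    by move/eqP; rewrite addrAC subr_eq0 => /eqP.
  rewrite wcoef_bracket_mono (h_weight _ k) // mulr0 subr0 /contraction big1 ?mulr0 // => l _.
  by rewrite h_weight // mulr0.
have hyA : co (bracket h y) (A + g) 0 = 0.
  rewrite wcoef_bracket_curve_field addrAC subrr add0r wg mul0r subr0 /contraction.
  by rewrite big1 ?mulr0 // => l _; rewrite h0 ?mulr0.
rewrite D2x D2y !D2E !wcoefD hx hyA !addr0 !(wcoef_derivation_windowed dD3 D3d) // lowA lowa.
by rewrite y0 mulr1 ![_ + g]addrC !addrK -/A (multiplierMn dD3 D3d) // mulrA.
Qed.

(** The factor in [twolocal_natmul] involves m, but it is the same for x and for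
    [curve_field a], which has coefficient 1 at d_0. *)
Lemma twolocal_coef x a g k : windowed x -> in_Z M a ->
    (forall l, (l < n)%N -> g@_l = 0) ->
  co (Delta x) (a + g) k = co (Delta (curve_field a)) (a + g) 0 * co x a k.
Proof.
move=> xW az g0; have [a0|a0] := eqVneq a 0.
  have [D [dD Dx Dd]] := locD x d; rewrite a0 Delta_d wcoef0 mul0r Dx.
  have z0 : in_Z M 0 by move=> l _; rewrite mcoeff0.
  rewrite (wcoef_derivation_windowed dD) -?Dd // low_add // add0r subr0.
  by rewrite (multiplier0 dD) -?Dd // ?mul0r //; lia.
have [m am] := natmul_avoid (a :: [seq p.1 | p <- support B x]) a0.
have scaled z : windowed z -> (forall i, co z (a - a *+ m.+1) i = 0) ->
  co (Delta z) (a + g) =1 fun k => m.+1%:R^-1 *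
    co (Delta (curve_field (a *+ m.+1))) (a *+ m.+1 + g) 0 * co z a k.
  move=> zW z0 i; apply: (mulfI (x := m.+1%:R)); first by rewrite pnatr_eq0.
  by rewrite (twolocal_natmul i zW az g0 z0) !mulrA mulfV ?mul1r // pnatr_eq0.
rewrite !scaled //; first by rewrite wcoef_curve_field eqxx expr0 !mulr1.
- exact: windowed_curve_field.
- move=> i; rewrite wcoef_curve_field (negPf (am a _)) ?mul0r //.
  by rewrite inE eqxx.
- move=> i; apply/eqP; apply: contraT => /wcoef_support px.
  have /am : a - a *+ m.+1 \in a :: [seq p.1 | p <- support B x].
    by rewrite inE; apply/orP; right; apply/mapP; exists (a - a *+ m.+1, i).
  by rewrite eqxx.
Qed.

(** All factors of Delta on the degrees in the list can be read off from its
    value at X, the sum of the t^a d_0 over these degrees; and a derivation that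
    agrees with Delta at X and at d has the same factors. *)
Lemma twolocal_agrees (s : seq L) : (forall x, x \in s -> windowed x) ->
  exists2 D, is_derivation D & forall x, x \in s -> Delta x = D x.
Proof.
move=> sW; pose S := undup
  [seq p.1 | x <- s, p <- [seq q <- support B x | co x q.1 q.2 != 0]].
have SP x a i : x \in s -> co x a i != 0 -> a \in S.
  move=> xs xa; rewrite mem_undup; apply/allpairsPdep; exists x, (a, i).
  by rewrite mem_filter /= xa wcoef_support.
have Sz a : a \in S -> in_Z M a.
  rewrite mem_undup => /allpairsPdep[x [[b i] [xs]]].
  by rewrite mem_filter => /andP[/= /(sW x xs)[bz _] _ ->].
pose X := \sum_(a <- S) t a 0.
have XE a i : co X a i = ((a \in S) && (i == 0%N))%:R.
  rewrite /X wcoef_sum; have [aS|aS] := boolP (a \in S); last first.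
    rewrite big_seq big1 // => b bS; rewrite wcoef_mono.
    by have [ba|//] := eqVneq b a; rewrite -ba bS in aS.
  rewrite (bigD1_seq a) ?undup_uniq //= wcoef_mono eqxx /= (eq_sym i).
  by rewrite big1 ?addr0 // => b ba; rewrite wcoef_mono (negPf ba).
have XW : windowed X.
  by move=> a i; rewrite XE; case: andP => [[/Sz ? /eqP ->]|]; rewrite ?eqxx.
have [D [dD DX Dd]] := locD X d; rewrite Delta_d in Dd.
exists D => // x xs; apply: (@wcoef_inj _ _ B) => e k.
have [D' [dD' D'x D'd]] := locD x d; rewrite Delta_d in D'd.
have [xe|xe] := eqVneq (co x (low n e) k) 0.
  rewrite D'x (wcoef_derivation_windowed dD') //; last exact: sW.
  by rewrite (wcoef_derivation_windowed dD) ?xe ?mulr0 //; exact: sW.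
have [lowS g0] : low n e \in S /\ forall l, (l < n)%N -> (e - low n e)@_l = 0.
  by split=> [|l ln]; [exact: SP xe|rewrite mcoeffB mcoeff_low ln subrr].
have eE : e = low n e + (e - low n e) by rewrite addrC subrK.
rewrite {1}eE (twolocal_coef k (sW x xs) (Sz _ lowS) g0) -eE.
rewrite (wcoef_derivation_windowed dD) -?Dd //; last exact: sW.
congr (_ * _); have := twolocal_coef 0 XW (Sz _ lowS) g0.
rewrite -eE XE lowS mulr1 => <-.
by rewrite DX (wcoef_derivation_windowed dD) -?Dd // XE lowS mulr1.
Qed.

End TwoLocal.
End GenericTorus.

(** * 2-local derivations are derivations *)

Section TwoLocalDerivations.
Context (K : numFieldType) (L : lieAlgType K) (B : witt_basis L).

Lemma windowed_seq (s : seq L) : exists M, forall x, x \in s -> windowed B M x.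
Proof.
have bound (r : seq nat) : exists M, forall i, i \in r -> (i < M)%N.
  exists (\sum_(i <- r) i).+1 => i ir.
  by rewrite ltnS (big_rem i ir) leq_addr.
have [M MP] := bound (flatten [seq flatten
  [seq p.2 :: enum_fset (msupp p.1) | p <- support B x] | x <- s]).
exists M => x xs a i xa; have ai := wcoef_support xa.
have mem j : j \in i :: enum_fset (msupp a) -> (j < M)%N.
  move=> ja; apply: MP; apply/flattenP.
  exists (flatten [seq p.2 :: enum_fset (msupp p.1) | p <- support B x]).
    by apply/mapP; exists x.
  apply/flattenP; exists (i :: enum_fset (msupp a)) => //.
  by apply/mapP; exists (a, i).
split=> [l Ml|].
  apply: mcoeff_outdom; apply: contraL Ml => la; rewrite -ltnNge.
  by apply: mem; rewrite inE la orbT.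
by have := mem i (mem_head _ _); lia.
Qed.

Lemma twolocal_derivation (c : K) (Delta : L -> L) :
    (forall n (f : nat -> int), \sum_(l < n) (f l)%:~R * c ^+ l = 0 ->
      forall l, (l < n)%N -> f l = 0) ->
  is_2local_derivation Delta -> is_derivation Delta.
Proof.
move=> c_indep locD.
have agree (s : seq L) :
    exists2 D, is_derivation D & forall x, x \in s -> Delta x = D x.
  have [M sM] := windowed_seq s; pose d := curve_field B c M 0.
  have [D0 [dD0 Dd _]] := locD d d.
  have loc' : is_2local_derivation (fun x => Delta x - D0 x).
    move=> x y; have [D [dD Dx Dy]] := locD x y.
    by exists (fun z => D z - D0 z); rewrite Dx Dy; split=> //; exact: is_derivationB.
  have [||D dD DE] := twolocal_agrees (c := c) (M := M) _ loc' _ sM.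
  - by move=> g; exact: (c_indep M.+3 (mcoeff ^~ g)).
  - by rewrite -/d Dd subrr.
  exists (fun x => D x + D0 x); first exact: is_derivationD.
  by move=> x /DE <-; rewrite subrK.
split=> [r x y|x y].
  have [D [DL _] DE] := agree [:: x; y; r *: x + y].
  by rewrite !DE ?inE ?eqxx ?orbT //; exact: DL.
have [D [_ DM] DE] := agree [:: x; y; bracket x y].
by rewrite !DE ?inE ?eqxx ?orbT //; exact: DM.
Qed.

End TwoLocalDerivations.

(** * The Witt algebra over the complex numbers *)

Definition Winf_basis (K : numFieldType) : witt_basis (Winf K).
Proof.
apply: (@WittBasis K (Winf K) (td K) (fun x a i => x@_(a, i)) (fun x => msupp x)).
- by move=> a i r x y; rewrite mcoeffD mcoeffZ.
- by move=> a i b j; rewrite mcoeffU xpair_eqE.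
- by move=> x; rewrite {1}[x]Winf_sumE; apply: eq_bigr => -[a i].
- exact: Winf_bracket_td.
Defined.

(** The roots of nonzero integer polynomials form a countable set, which has
    Lebesgue measure zero and so does not contain the unit interval. *)
Lemma exists_transcendental (R : realType) :
  exists c : R, forall p : {poly int}, p != 0 -> (map_poly intr p).[c] != 0.
Proof.
apply: contrapT => noc.
pose A := (\bigcup_(p in [set p : {poly int} | p != 0])
  [set c : R | root (map_poly intr p) c])%classic.
have cA : countable A.
  apply: bigcup_countable => [|p /= p0]; first exact: countableP.
  have q0 : map_poly intr p != 0 :> {poly R}.
    by rewrite map_poly_eq0_id0 // intr_eq0 lead_coef_eq0.
  apply: finite_set_countable.
  apply: (@sub_finite_set _ _ [set` rootsR (map_poly intr p : {poly R})]%classic).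
    by move=> c /= rc; rewrite -(roots_on_rootsR q0) inE.
  exact: finite_seq.
have AT : A = setT.
  rewrite -subTset => c _; apply: contrapT => Ac; apply: noc; exists c => p p0.
  by apply/negP => pc; apply: Ac; exists p.
have /countable_lebesgue_measure0 : countable `[0 : R, 1]%classic.
  by apply: sub_countable cA; apply: subset_card_le; rewrite AT.
rewrite lebesgue_measure_itv /= lte_fin ltr01 oppr0 adde0 => /eqP.
by rewrite eqe oner_eq0.
Qed.

Lemma complex_powers_independent (R : realType) : exists c : R[i],
  forall n (f : nat -> int), \sum_(l < n) (f l)%:~R * c ^+ l = 0 ->
  forall l, (l < n)%N -> f l = 0.
Proof.
have [c cP] := exists_transcendental R; exists (real_complex R c) => n f f0 l ln.
pose p := \poly_(l < n) f l; have p0 : p = 0.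
  apply/eqP; apply: contraT => /cP /eqP[]; apply: (fmorph_inj (real_complex R)).
  rewrite [RHS]rmorph0 -f0 (@horner_coef_wide _ n); last first.
    exact: leq_trans (size_poly _ _) (size_poly _ _).
  rewrite rmorph_sum; apply: eq_bigr => i _.
  by rewrite coef_map coef_poly ltn_ord rmorphM rmorphXn /= rmorph_int.
by have := congr1 (coefp l) p0; rewrite /= coef_poly ln coef0.
Qed.

Theorem theorem4p5 (R : realType) (Delta : Winf R[i] -> Winf R[i]) :
  is_2local_derivation Delta -> is_derivation Delta.
Proof.
have [c c_indep] := complex_powers_independent R.
exact: (twolocal_derivation (Winf_basis R[i]) c_indep).
Qed.
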